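(* Let $m\ge1$, $n\ge1$, and let $Q=A_m\square A_{2n-1}^{(1)}$ with initial cluster variables $x_v$ and bipartite mutation map $\mu=\mu_-\mu_+$ acting on $\mathbb F=\mathbb C(x_v:v\in Q)$. Let $q$ be the $j$-th vertex of $A_m$ counting from one of its ends ($1\le j\le m$), and let $q'$ be any vertex of $A_{2n-1}^{(1)}$. Then the sequence $(\mu^k(x_{(q,q')}))_{k\in\mathbb Z}$ is linearizable of order $n\binom{m+1}{j}$.
   Context: Quivers and mutation. A quiver is a directed graph without loops or directed 2-cycles; multiple arrows are allowed. Mutation $\mu_z$ at a vertex $z$ changes the quiver as follows. For each pair of arrows $y\to z\to y'$ an arrow $y\to y'$ is added. Then all arrows at $z$ are reversed. Then directed 2-cycles are cancelled. The variable at $z$ is replaced by $z'$ with $zz'=\prod_{y\to z}y+\prod_{z\to y}y$, arrows counted with multiplicity; other variables are unchanged. Box product. For bipartite graphs $Q=Q_0\sqcup Q_1$ and $Q'=Q_0'\sqcup Q_1'$, the box product $Q\square Q'$ has vertex set $Q\times Q'$. Each edge $q_1'q_2'$ of $Q'$ and each $q\in Q$ gives an edge between $(q,q_1')$ and $(q,q_2')$. Each edge $q_1q_2$ of $Q$ and each $q'\in Q'$ gives an edge between $(q_1,q')$ and $(q_2,q')$. Edges are oriented from $Q_0\times Q_0'$ to $Q_1\times Q_0'$, from $Q_1\times Q_0'$ to $Q_1\times Q_1'$, from $Q_1\times Q_1'$ to $Q_0\times Q_1'$, and from $Q_0\times Q_1'$ to $Q_0\times Q_0'$. The two factors. $A_m$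 is the path on $m$ vertices. $A_{2n-1}^{(1)}$ is the cycle on $2n$ vertices; for $n=1$ it is two vertices joined by a double edge. Both are bipartitioned by alternation. The map $\mu$. Black vertices are $Q_0\times Q_0'\cup Q_1\times Q_1'$; the others are white. $\mu_+$ mutates at all black vertices and $\mu_-$ at all white vertices. $\mu_-\mu_+$ (first $\mu_+$) returns the original quiver, so it defines a field automorphism $\mu$ of $\mathbb F$ sending $x_v$ to the new variable at $v$. Linearizability. A sequence $(a_k)_{k\in\mathbb Z}$ is linearizable of order $r$ if $a_k=c_1a_{k-1}+\dots+c_ra_{k-r}$ for all $k\in\mathbb Z$, for some constants $c_1,\dots,c_r\in\mathbb F$ independent of $k$. *)

(* Defs.v *)
From HB Require Import structures.
From mathcomp Require Import all_boot all_order all_algebra.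
From mathcomp Require Import fraction complex mpoly reals.

Set Implicit Arguments.
Unset Strict Implicit.
Unset Printing Implicit Defensive.

Import GRing.Theory.
Local Open Scope ring_scope.

(* A quiver on V is given by its arrow counts: b u v arrows u -> v. *)
Section QuiverMutation.
Variables (V : finType) (F : fieldType).

Definition arrows := V -> V -> nat.

Definition compose_at (z : V) (b : arrows) : arrows :=
  fun y y' => (b y y' + b y z * b z y')%N.

Definition reverse_at (z : V) (b : arrows) : arrows :=
  fun y y' => if (y == z) || (y' == z) then b y' y else b y y'.

(* The subtraction is truncated. *)
Definition cancel_2cycles (b : arrows) : arrows :=
  fun y y' => (b y y' - b y' y)%N.

Definition mutate_quiver (z : V) (b : arrows) : arrows :=
  cancel_2cycles (reverse_at z (compose_at z b)).

Definition mutate_vars (z : V) (b : arrows) (x : V -> F) : V -> F :=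
  fun v => if v == z then
             (\prod_y x y ^+ b y z + \prod_y x y ^+ b z y) / x z
           else x v.

Definition seed := (arrows * (V -> F))%type.

Definition mutate (s : seed) (z : V) : seed :=
  (mutate_quiver z s.1, mutate_vars z s.1 s.2).

(* Used only on sets P of pairwise non-adjacent vertices, where the order of
   the mutations is immaterial. *)
Definition mutate_all (P : {pred V}) (s : seed) : seed :=
  foldl mutate s (enum P).

End QuiverMutation.

(* A finite multigraph on T is given by its edge multiplicities e; a
   bipartition T = T_0 + T_1 by the function c with T_1 = c @^-1: true. *)
Definition is_bipartition (T : finType) (e : T -> T -> nat) (c : T -> bool) :=
  forall i i' : T, (0 < e i i')%N -> c i != c i'.

Section BoxProduct.
Variables (T T' : finType) (e : T -> T -> nat) (e' : T' -> T' -> nat).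
Variables (c : T -> bool) (c' : T' -> bool).

Definition box_class (u : T * T') : bool * bool := (c u.1, c' u.2).

(* (i, j) stands for Q_i x Q'_j; edges are oriented from each class to the
   next one. *)
Definition next_class (p : bool * bool) : bool * bool :=
  match p with
  | (false, false) => (true, false)
  | (true, false) => (true, true)
  | (true, true) => (false, true)
  | (false, true) => (false, false)
  end.

Definition box_edges (u v : T * T') : nat :=
  ((u.1 == v.1) * e' u.2 v.2 + (u.2 == v.2) * e u.1 v.1)%N.

Definition box_arrows : arrows (T * T')%type :=
  fun u v => if next_class (box_class u) == box_class v
             then box_edges u v else 0%N.

Definition black : {pred T * T'} := [pred u | c u.1 == c' u.2].
Definition white : {pred T * T'} := [pred u | c u.1 != c' u.2].

Definition mu_plus (F : fieldType) (s : seed (T * T')%type F) :=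
  mutate_all black s.
Definition mu_minus (F : fieldType) (s : seed (T * T')%type F) :=
  mutate_all white s.

End BoxProduct.

Definition pathA (m : nat) : 'I_m -> 'I_m -> nat :=
  fun i i' => ((i' == i.+1 :> nat) + (i == i'.+1 :> nat))%N.

(* The 2n-cycle; for n = 1 both summands are 1 on a pair of distinct vertices,
   which gives the double edge. *)
Definition cycleA (n : nat) : 'I_(2 * n) -> 'I_(2 * n) -> nat :=
  fun i i' => ((i' == i.+1 %% (2 * n) :> nat)
             + (i == i'.+1 %% (2 * n) :> nat))%N.

(* The field C(x_v : v in V). *)
Definition ratfun (C : fieldType) (V : finType) : fieldType :=
  {fraction {mpoly C[#|V|]}}.

Definition ratX (C : fieldType) (V : finType) (v : V) : ratfun C V :=
  tofrac ('X_(enum_rank v) : {mpoly C[#|V|]}).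

Definition ratC (C : fieldType) (V : finType) (a : C) : ratfun C V :=
  tofrac (a%:MP : {mpoly C[#|V|]}).

Record field_aut (F : fieldType) := FieldAut {
  aut_fun :> {rmorphism F -> F};
  aut_inv : F -> F;
  aut_funK : cancel aut_fun aut_inv;
  aut_invK : cancel aut_inv aut_fun
}.

Definition aut_pow (F : fieldType) (s : field_aut F) (k : int) (f : F) : F :=
  match k with
  | Posz n => iter n s f
  | Negz n => iter n.+1 (aut_inv s) f
  end.

Section BipartiteMap.
Variables (C : fieldType) (T T' : finType).
Variables (e : T -> T -> nat) (e' : T' -> T' -> nat).
Variables (c : T -> bool) (c' : T' -> bool).

Definition initial_seed : seed (T * T')%type (ratfun C (T * T')%type) :=
  (box_arrows e e' c c', @ratX C (T * T')%type).

Definition new_var (v : T * T') : ratfun C (T * T')%type :=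
  (mu_minus c c' (mu_plus c c' initial_seed)).2 v.

(* These conditions determine mu, since C and the x_v generate the field. *)
Definition is_bipartite_map (mu : field_aut (ratfun C (T * T')%type)) :=
  (forall a : C, mu (ratC _ a) = ratC _ a) /\
  (forall v : T * T', mu (ratX C v) = new_var v).

End BipartiteMap.

Definition linearizable (F : fieldType) (a : int -> F) (r : nat) :=
  exists d : 'I_r -> F,
    forall k : int, a k = \sum_(i < r) d i * a (k - i.+1%:Z).

(* Main.v *)
Require Import Defs.
From HB Require Import structures.
From mathcomp Require Import all_boot all_order fingroup perm all_algebra.
From mathcomp Require Import generic_quotient fraction complex mpoly reals.
From mathcomp Require Import zify ring.

Set Implicit Arguments.
Unset Strict Implicit.
Unset Printing Implicit Defensive.

Import GRing.Theory.
Local Open Scope ring_scope.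

(**
The exchange relations form the octahedron recurrence
  T_i(x,y) T_i(x+1,y+1) = T_(i-1)(x+1,y+1) T_(i+1)(x,y) + T_i(x+1,y) T_i(x,y+1)
where i is the level in A_m, x - y the position on the cycle, x + y + i - 1 the
time, and T_0 = T_(m+1) = 1. By the Desnanot-Jacobi identity T_i is the solid
i x i minor of the array a = T_1. So all solid minors of a of size d = m + 1 are
1 and those of size d + 1 vanish, which makes the d x d blocks satisfy
A(x,y) = K(x) A(x+1,y) with K(x) independent of y. Going once around the cycle
gives a(x+n,y) = a(x,y+n), hence A(x,y+n) = H(x) A(x,y). Moving by n in both
directions is n applications of mu; it multiplies A(x,y) by H(x)^2 up to a
change of basis, and its j x j minors evolve under the j-th compound matrix of
H(x)^2, of size C(d,j). Cayley-Hamilton gives the recurrence, and its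
coefficients do not depend on x because H(x) K(x) = K(x) H(x+1).

For the existence of mu: the substitution at the black (white) vertices is an
involution, and mu is the composition of the two.
*)

(** * Compound matrices *)

Section CauchyBinet.
Variables (R : comPzRingType) (d j : nat).

Definition jset := {S : {set 'I_d} | #|S| == j}.

Lemma card_jset : #|{: jset}| = 'C(d, j).
Proof. by rewrite card_sig -[d in RHS]card_ord -card_draws cardsE. Qed.

Definition jset_nth (S : jset) (i : 'I_j) : 'I_d :=
  enum_val (cast_ord (esym (eqP (valP S))) i).

Lemma jset_nth_inj (S : jset) : injective (jset_nth S).
Proof. by move=> i k /enum_val_inj /cast_ord_inj. Qed.

Lemma imset_jset_nth (S : jset) : [set jset_nth S i | i : 'I_j] = val S.
Proof.
apply/eqP; rewrite eqEcard card_imset ?card_ord; last exact: jset_nth_inj.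
rewrite (eqP (valP S)) leqnn andbT; apply/subsetP=> _ /imsetP[i _ ->].
exact: enum_valP.
Qed.

(** Every injection is, in exactly one way, a permutation followed by the enumeration of its
    image. *)
Let arrange (p : (jset * 'S_j)%type) : {ffun 'I_j -> 'I_d} :=
  [ffun i => jset_nth p.1 (p.2 i)].

Let arrange_inj : injective arrange.
Proof.
move=> [S s] [S' s'] /ffunP eq_arr.
have eqS : S = S'.
  apply: val_inj => /=; rewrite -!imset_jset_nth.
  have permT (u : 'S_j) (T : jset) :
      [set jset_nth T i | i : 'I_j] = [set arrange (T, u) i | i : 'I_j].
    apply/setP=> x; apply/imsetP/imsetP=> -[i _ ->].
      by exists (u^-1%g i); rewrite // ffunE /= permKV.
    by exists (u i); rewrite // ffunE.
  by rewrite (permT s) (permT s'); apply: eq_imset => i; apply: eq_arr.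
rewrite -{S'}eqS in eq_arr *; congr (_, _); apply/permP=> i.
by have := eq_arr i; rewrite !ffunE => /jset_nth_inj.
Qed.

Let arrange_imset :
  [set arrange p | p : (jset * 'S_j)%type] =
  [set f : {ffun 'I_j -> 'I_d} | injectiveb f].
Proof.
apply/eqP; rewrite eqEcard; apply/andP; split.
  apply/subsetP=> _ /imsetP[p _ ->]; rewrite inE; apply/injectiveP=> i k.
  by rewrite !ffunE => /jset_nth_inj /perm_inj.
(* Inclusion becomes equality by counting: there are C(d, j) j! pairs and as many injections. *)
rewrite card_imset; last exact: arrange_inj.
by rewrite card_inj_ffuns !card_ord card_prod card_jset card_Sn bin_ffact.
Qed.

Lemma jset_nthP (f : 'I_j -> 'I_d) :
  injective f -> exists S (s : 'S_j), f =1 jset_nth S \o s.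
Proof.
move=> f_inj; have : finfun f \in [set arrange p | p : (jset * 'S_j)%type].
  rewrite arrange_imset inE; apply/injectiveP=> i k.
  by rewrite !ffunE => /f_inj.
case/imsetP=> -[S s] _ /ffunP eq_f; exists S, s => i.
by have := eq_f i; rewrite !ffunE.
Qed.

Lemma det_mulmx_ffun (A : 'M[R]_(j, d)) (B : 'M[R]_(d, j)) :
  \det (A *m B) =
  \sum_(f : {ffun 'I_j -> 'I_d}) (\prod_i A i (f i)) * \det (rowsub f B).
Proof.
rewrite [LHS]/determinant.
under eq_bigr => s _.
  under eq_bigr => i _ do rewrite mxE.
  rewrite bigA_distr_bigA big_distrr /=.
  under eq_bigr => f _ do rewrite big_split mulrCA.
  over.
rewrite exchange_big /=; apply: eq_bigr => f _.
rewrite -big_distrr /=; congr (_ * _); apply: eq_bigr => s _; congr (_ * _).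
by apply: eq_bigr => i _; rewrite mxE.
Qed.

(** A map [f] that is not injective repeats a row of [B] and contributes 0. The injective ones are
    grouped by image; the sum over permutations is then the determinant of the chosen columns of
    [A]. *)
Theorem Cauchy_Binet (A : 'M[R]_(j, d)) (B : 'M[R]_(d, j)) :
  \det (A *m B) =
  \sum_(S : jset) \det (colsub (jset_nth S) A) * \det (rowsub (jset_nth S) B).
Proof.
rewrite det_mulmx_ffun (bigID (fun f : {ffun 'I_j -> 'I_d} => injectiveb f)) /=.
rewrite [X in _ + X]big1 ?addr0 => [|f /injectivePn[i [k ne_ik eq_f]]]; last first.
  rewrite (determinant_alternate ne_ik) ?mulr0 // => l.
  by rewrite !mxE eq_f.
rewrite -big_set /= -arrange_imset big_imset /=; last first.
  by move=> ? ? _ _; apply: arrange_inj.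
rewrite (eq_bigl xpredT) // -(pair_bigA _ (fun S s => (\prod_i A i (arrange (S, s) i)) *
  \det (rowsub (arrange (S, s)) B))) /=.
apply: eq_bigr => S _; rewrite [X in X * _]/determinant big_distrl /=.
apply: eq_bigr => s _.
have -> : rowsub (arrange (S, s)) B = row_perm s (rowsub (jset_nth S) B).
  by apply/matrixP=> i k; rewrite !mxE ffunE.
rewrite row_permE det_mulmx det_perm mulrA; congr (_ * _).
rewrite mulrC; congr (_ * _).
by apply: eq_bigr => i _; rewrite mxE ffunE.
Qed.

(** Rows and columns are numbered by ordinals through [enum_val] so that [char_poly] and
    Cayley-Hamilton apply. *)
Definition compound (A : 'M[R]_d) : 'M[R]_#|{: jset}| :=
  \matrix_(a, b) \det (mxsub (jset_nth (enum_val a)) (jset_nth (enum_val b)) A).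

Lemma compoundM (A B : 'M[R]_d) : compound (A *m B) = compound A *m compound B.
Proof.
apply/matrixP=> a b; rewrite !mxE.
have -> : mxsub (jset_nth (enum_val a)) (jset_nth (enum_val b)) (A *m B) =
  rowsub (jset_nth (enum_val a)) A *m colsub (jset_nth (enum_val b)) B.
  by apply/matrixP=> i k; rewrite !mxE; apply: eq_bigr => l _; rewrite !mxE.
rewrite Cauchy_Binet (reindex (@enum_val _ predT)) /=; last first.
  exact: (onW_bij _ (@enum_val_bij _)).
apply: eq_bigr => i _; rewrite !mxE.
by congr (_ * _); congr (\det _); apply/matrixP=> ? ?; rewrite !mxE.
Qed.

Lemma compound1 : compound 1%:M = 1%:M.
Proof.
apply/matrixP=> a b; rewrite !mxE; case: eqVneq => [<-|neq_ab].
  rewrite -[RHS](det1 _ j); congr (\det _); apply/matrixP=> i k.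
  by rewrite !mxE (inj_eq (@jset_nth_inj _)).
(* Of two different sets of equal size, the first has an element outside the second; its row in this
   minor of the identity is zero. *)
have /subsetPn[x] : ~~ (val (enum_val a) \subset val (enum_val b)).
  apply: contra neq_ab => sub; apply/eqP/enum_val_inj/val_inj/eqP => /=.
  by rewrite eqEcard sub (eqP (valP (enum_val a))) (eqP (valP (enum_val b))) leqnn.
rewrite -imset_jset_nth => /imsetP[i _ ->] notin.
rewrite (expand_det_row _ i) big1 // => k _; rewrite !mxE.
case: eqP => [eq_ik|_]; last by rewrite mul0r.
by case/negP: notin; rewrite eq_ik -imset_jset_nth imset_f.
Qed.

End CauchyBinet.

(** * Characteristic polynomials and recurrences for minors *)

Lemma char_poly_similar (R : comNzRingType) n (P Q A : 'M[R]_n) :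
  Q *m P = 1%:M -> char_poly (P *m A *m Q) = char_poly A.
Proof.
move=> QP1; have PQ1 := mulmx1C QP1; rewrite /char_poly /char_poly_mx.
have -> : 'X%:M - map_mx polyC (P *m A *m Q) =
  map_mx polyC P *m ('X%:M - map_mx polyC A) *m map_mx polyC Q.
  rewrite mulmxBr mulmxBl !map_mxM /=; congr (_ - _).
  by rewrite scalar_mxC -mulmxA -map_mxM PQ1 map_mx1 mulmx1.
by rewrite !det_mulmx mulrC mulrA -det_mulmx -map_mxM QP1 map_mx1 det1 mul1r.
Qed.

Lemma Cayley_Hamilton_orbit (R : comNzRingType) n p (A : 'M[R]_n)
    (B : nat -> 'M[R]_(n, p)) :
    (0 < n)%N -> (forall s, B s.+1 = A *m B s) ->
  \sum_(s < n.+1) (char_poly A)`_s *: B s = 0.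
Proof.
case: n A B => // n A B _ stepB.
have -> : \sum_(s < n.+2) (char_poly A)`_s *: B s = horner_mx A (char_poly A) *m B 0.
  rewrite -[in RHS](coefK (char_poly A)) size_char_poly.
  rewrite poly_def rmorph_sum /= mulmx_suml; apply: eq_bigr => s _.
  rewrite linearZ /= rmorphXn /= horner_mx_X -scalemxAl; congr (_ *: _).
  elim: (s : nat) => [|k IHk]; first by rewrite mul1mx.
  by rewrite stepB IHk exprS -mulmxA.
by rewrite Cayley_Hamilton mul0mx.
Qed.


(** For fixed columns [g], Cauchy-Binet makes [compound j W] advance the vector of minors of [B s]
    by one step, so Cayley-Hamilton applies to this vector. *)
Lemma compound_recurrence (R : comNzRingType) d j (W : 'M[R]_d) (B : nat -> 'M[R]_d)
    (f g : 'I_j -> 'I_d) :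
    injective f -> (forall s, B s.+1 = W *m B s) ->
  \sum_(s < 'C(d, j).+1) (char_poly (compound j W))`_s * \det (mxsub f g (B s)) = 0.
Proof.
move=> f_inj stepB; have [S [u eq_f]] := jset_nthP f_inj.
pose b s : 'cV_#|{: jset d j}| := \col_i \det (mxsub (jset_nth (enum_val i)) g (B s)).
have stepb s : b s.+1 = compound j W *m b s.
  apply/matrixP=> i k; rewrite !mxE stepB.
  have -> : mxsub (jset_nth (enum_val i)) g (W *m B s) =
      rowsub (jset_nth (enum_val i)) W *m colsub g (B s).
    by apply/matrixP=> ? ?; rewrite !mxE; apply: eq_bigr => l _; rewrite !mxE.
  rewrite Cauchy_Binet (reindex (@enum_val _ predT)) /=; last first.
    exact: (onW_bij _ (@enum_val_bij _)).
  apply: eq_bigr => l _; rewrite !mxE.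
  by congr (_ * _); congr (\det _); apply/matrixP=> ? ?; rewrite !mxE.
have /(Cayley_Hamilton_orbit (A := compound j W)) : (0 < #|{: jset d j}|)%N.
  by apply/card_gt0P; exists S.
(* The rows [f] are those of [S] permuted by [u]; the sign of [u] turns one minor into the other. *)
move=> /(_ _ b stepb) /matrixP /(_ (enum_rank S) 0) /(congr1 ( *%R ((-1) ^+ u))).
rewrite !mxE mulr0 summxE big_distrr /= => sum0; rewrite -card_jset -[RHS]sum0.
apply: eq_bigr => s _; rewrite !mxE mulrCA enum_rankK; congr (_ * _).
have -> : mxsub f g (B s) = row_perm u (mxsub (jset_nth S) g (B s)).
  by apply/matrixP=> ? ?; rewrite !mxE eq_f.
by rewrite row_permE det_mulmx det_perm.
Qed.

(** * Solid minors and the octahedron recurrence *)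

Section Dodgson.
Variable F : fieldType.

Lemma det_Schur n p (Z : 'M[F]_p) (R : 'M_(p, n)) (C : 'M_(n, p)) (E : 'M_n) :
  E \in unitmx -> \det (block_mx Z R C E) = \det (Z - R *m invmx E *m C) * \det E.
Proof.
move=> uE.
have -> : block_mx Z R C E =
    block_mx 1%:M (R *m invmx E) 0 1%:M *m block_mx (Z - R *m invmx E *m C) 0 C E.
  by rewrite mulmx_block !mul1mx !mul0mx !add0r mulmxKV // subrK.
by rewrite det_mulmx det_ublock det_lblock !det1 !mul1r.
Qed.

Lemma det_mx22 (A : 'M[F]_2) : \det A = A 0 0 * A 1 1 - A 0 1 * A 1 0.
Proof.
rewrite (expand_det_row _ ord0) big_ord_recl big_ord1 /cofactor !det_mx11 !mxE.
rewrite expr0 expr1 mul1r mulN1r mulrN.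
by congr (A _ _ * A _ _ - A _ _ * A _ _); apply/val_inj.
Qed.

Lemma det_mxsub_perm n (s t : 'S_n) (A : 'M[F]_n) :
  \det (mxsub s t A) = (-1) ^+ s * (-1) ^+ t * \det A.
Proof.
have -> : mxsub s t A = row_perm s (col_perm t A).
  by apply/matrixP=> i k; rewrite !mxE.
rewrite row_permE col_permE !det_mulmx !det_perm odd_permV.
by rewrite mulrA mulrAC.
Qed.

Variable a : int -> int -> F.

Definition solid_mx k (x y : int) : 'M[F]_k := \matrix_(i, l) a (x + i%:Z) (y + l%:Z).
Definition solid_minor k x y := \det (solid_mx k x y).

(* The rows p, x + 1, .., x + k against the columns q, y + 1, .., y + k. *)
Let bordered_mx k (x y p q : int) : 'M[F]_k.+1 :=
  \matrix_(i, l) a (if i == 0 then p else x + i%:Z) (if l == 0 then q else y + l%:Z).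

(** The 1 x 1 Schur complement of the core block at (x + 1, y + 1) in the matrix bordered by row [p]
    and column [q]. *)
Let residue k (x y p q : int) : F :=
  a p q - ((\row_l a p (y + 1 + l%:Z)) *m invmx (solid_mx k (x + 1) (y + 1))
            *m (\col_i a (x + 1 + i%:Z) q)) 0 0.

Let det_bordered k (x y p q : int) : solid_minor k (x + 1) (y + 1) != 0 ->
  \det (bordered_mx k x y p q) =
  residue k x y p q * solid_minor k (x + 1) (y + 1).
Proof.
move=> nz; rewrite -[bordered_mx _ _ _ _ _](@submxK _ 1 k 1 k).
have -> : drsubmx (bordered_mx k x y p q : 'M_(1 + k)) = solid_mx k (x + 1) (y + 1).
  by apply/matrixP=> i l; rewrite !mxE /= /bump !PoszD !addrA.
have -> : ursubmx (bordered_mx k x y p q : 'M_(1 + k)) = \row_l a p (y + 1 + l%:Z).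
  by apply/matrixP=> i l; rewrite !mxE ord1 /= !PoszD !addrA.
have -> : dlsubmx (bordered_mx k x y p q : 'M_(1 + k)) = \col_l a (x + 1 + l%:Z) q.
  by apply/matrixP=> i l; rewrite !mxE (ord1 l) /= !PoszD !addrA.
rewrite (@det_Schur k 1) ?unitmxE ?unitfE //; congr (_ * _).
by rewrite det_mx11 mxE [(- _ : 'M_1) _ _]mxE 3!mxE /=.
Qed.

(** The cyclic shift moves a border from the first place to the last. *)
Let cyc k : 'S_k.+1 := perm (@ordS_inj k.+1).

Let cycE k (i : 'I_k.+1) : cyc k i = (i.+1 %% k.+1)%N :> nat.
Proof. by rewrite permE. Qed.

Let sqr_sign k (s : 'S_k) : (-1) ^+ s * (-1) ^+ s = 1 :> F.
Proof. by rewrite -expr2 sqrr_sign. Qed.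

(** All the minors contain the same invertible core. By Schur complements each minor of size k + 1
    is a residue times the core minor, up to sign, and the one of size k + 2 is a 2 x 2 determinant
    of residues times it. *)
Theorem Desnanot_Jacobi k (x y : int) : solid_minor k (x + 1) (y + 1) != 0 ->
  solid_minor k.+2 x y * solid_minor k (x + 1) (y + 1) =
  solid_minor k.+1 x y * solid_minor k.+1 (x + 1) (y + 1)
  - solid_minor k.+1 (x + 1) y * solid_minor k.+1 x (y + 1).
Proof.
move=> nz; pose r := x + k.+1%:Z; pose c := y + k.+1%:Z.
have cyc_border z (i : 'I_k.+1) :
    (if cyc k i == 0 then z + k.+1%:Z else z + (cyc k i)%:Z) = z + 1 + i%:Z.
  rewrite -val_eqE /= cycE; have := ltn_ord i; rewrite ltnS leq_eqVlt.
  case/predU1P=> [->|lt_ik]; first by rewrite modnn /= -addn1 PoszD; ring.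
  by rewrite modn_small ?ltnS //= -addn1 PoszD; ring.
have D00 : solid_minor k.+1 x y = \det (bordered_mx k x y x y).
  congr (\det _); apply/matrixP=> i l; rewrite !mxE.
  by do 2?[case: eqP => [->|_]]; rewrite /= ?addr0.
have D11 : solid_minor k.+1 (x + 1) (y + 1) = \det (bordered_mx k x y r c).
  rewrite -[RHS]mul1r -(sqr_sign (cyc k)) -det_mxsub_perm; congr (\det _).
  by apply/matrixP=> i l; rewrite !mxE !cyc_border.
have sign1 : (-1) ^+ (1%g : 'S_k.+1) = 1 :> F by rewrite odd_perm1.
(* Each of these two minors needs a single cyclic shift; the two signs cancel in the product. *)
have D10D01 : solid_minor k.+1 (x + 1) y * solid_minor k.+1 x (y + 1) =
    \det (bordered_mx k x y r y) * \det (bordered_mx k x y x c).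
  have -> : solid_minor k.+1 (x + 1) y = (-1) ^+ cyc k * \det (bordered_mx k x y r y).
    rewrite -[X in X * _]mulr1 -[X in _ * X * _]sign1 -det_mxsub_perm.
    congr (\det _); apply/matrixP=> i l; rewrite !mxE !cyc_border perm1.
    by case: eqP => [->|_]; rewrite /= ?addr0.
  have -> : solid_minor k.+1 x (y + 1) = (-1) ^+ cyc k * \det (bordered_mx k x y x c).
    rewrite -[X in X * _]mul1r -[X in X * _ * _]sign1 -det_mxsub_perm.
    congr (\det _); apply/matrixP=> i l; rewrite !mxE !cyc_border perm1.
    by case: eqP => [->|_]; rewrite /= ?addr0.
  by rewrite mulrACA sqr_sign mul1r.
pose E := solid_mx k (x + 1) (y + 1).
pose b2 : 'M[F]_(2 + k) := block_mx
  (\matrix_(i < 2, l < 2) a (if i == 0 then x else r) (if l == 0 then y else c))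
  (\matrix_(i < 2, l < k) a (if i == 0 then x else r) (y + 1 + l%:Z))
  (\matrix_(i < k, l < 2) a (x + 1 + i%:Z) (if l == 0 then y else c)) E.
(* In [b2] the offsets 0 and k + 1 come first and the core follows. [f z i] is the index in place
   [i] of this order, and [s] gives the place of each offset. *)
have D2 : solid_minor k.+2 x y = \det b2.
  pose s := lift_perm ord0 ord0 (cyc k).
  rewrite -[RHS]mul1r -(sqr_sign s) -det_mxsub_perm; congr (\det _).
  pose f (z : int) (i : nat) :=
    z + (match i with 0 => 0 | 1 => k.+1 | i'.+1 => i' end)%N%:Z.
  have f2 z (i : 'I_2) : f z i = if i == 0 then z else z + k.+1%:Z.
    by case: i => [[|[|?]] ?] //=; rewrite /f addr0.
  have fk z (i : 'I_k) : f z (2 + i)%N = z + 1 + i%:Z.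
    by rewrite /f /= -addrA -PoszD add1n.
  have b2E i l : b2 i l = a (f x i) (f y l).
    rewrite /b2 !mxE; case: splitP => i' ->; rewrite !mxE; case: splitP => l' ->;
    by rewrite !mxE ?f2 ?fk.
  have fs z (i : 'I_k.+2) : f z (s i) = z + i%:Z.
    case: (unliftP ord0 i) => [i'|] ->; last by rewrite lift_perm_id.
    rewrite lift_perm_lift /f !lift0 /= cycE.
    have := ltn_ord i'; rewrite ltnS leq_eqVlt => /predU1P[->|lt_ik].
      by rewrite modnn.
    by rewrite modn_small.
  by apply/matrixP=> i l; rewrite [in RHS]mxE b2E !fs mxE.
rewrite D2 D10D01 D00 D11 !det_bordered // /b2 (@det_Schur k 2) ?unitmxE ?unitfE //.
rewrite det_mx22.
pose Z (i l : 'I_2) := residue k x y (if i == 0 then x else r) (if l == 0 then y else c).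
have ZE i l : ((\matrix_(i < 2, l < 2) a (if i == 0 then x else r) (if l == 0 then y else c)) -
  (\matrix_(i < 2, l < k) a (if i == 0 then x else r) (y + 1 + l%:Z)) *m invmx E *m
  (\matrix_(i < k, l < 2) a (x + 1 + i%:Z) (if l == 0 then y else c))) i l = Z i l.
  rewrite /Z /residue !mxE; congr (_ - _); apply: eq_bigr => h _.
  rewrite !mxE; congr (_ * _); apply: eq_bigr => h' _; by rewrite !mxE.
rewrite !ZE /Z /= -/(solid_minor _ _ _); ring.
Qed.

(** * Arrays with d-minors 1 and vanishing (d+1)-minors *)

Section RankRecurrence.
Variables (d : nat).
Hypotheses (minor_d : forall x y, solid_minor d x y = 1)
  (minor_dS : forall x y, solid_minor d.+1 x y = 0).

Let unit_d x y : solid_mx d x y \in unitmx.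
Proof. by rewrite unitmxE -/(solid_minor d x y) minor_d unitr1. Qed.

(** Equivalently, A(x,y) A(x+1,y)^-1 does not change when [y] grows by 1. Only the column [y] is
    new; it is determined by the vanishing of the bordered minors. *)
Lemma solid_mx_step x y : solid_mx d x y =
  solid_mx d x (y + 1) *m invmx (solid_mx d (x + 1) (y + 1)) *m solid_mx d (x + 1) y.
Proof.
set K := _ *m invmx _.
have Ky (i : 'I_d) : a (x + i%:Z) y = (K *m \col_r a (x + 1 + r%:Z) y) i 0.
  have nz : solid_minor d (x + 1) (y + 1) != 0 by rewrite minor_d oner_eq0.
  have det0 : \det (bordered_mx d x y (x + i%:Z) y) = 0.
    (* For i = 0 the bordered matrix is the solid one of size d + 1; for i > 0 its border row
       repeats a core row. *)
    case: (posnP i) => [i0|i_gt0].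
      rewrite -[RHS](minor_dS x y); congr (\det _); apply/matrixP=> r l; rewrite !mxE.
      by do 2?[case: eqP => [->|_]]; rewrite /= ?i0 ?addr0.
    have ne0i : ord0 != lift ord_max i 
      by rewrite eq_sym -(inj_eq val_inj) [val _]lift_max -lt0n.
    apply: (determinant_alternate ne0i) => l.
    rewrite !mxE eqxx (_ : (lift ord_max i == 0) = false) ?lift_max //.
    by rewrite eq_sym; apply: negPf.
  move: det0; rewrite det_bordered // minor_d mulr1 /residue => /eqP.
  rewrite subr_eq0 => /eqP ->.
  have -> : \row_l a (x + i%:Z) (y + 1 + l%:Z) = row i (solid_mx d x (y + 1)).
    by apply/matrixP=> r l; rewrite !mxE.
  by rewrite -!row_mul mxE.
apply/matrixP=> i l; rewrite [LHS]mxE.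
case: (posnP l) => [l0|l_gt0].
  rewrite l0 addr0 Ky !mxE; apply: eq_bigr => r _; rewrite !mxE l0 addr0 //.
have lt_l : (l.-1 < d)%N by apply: leq_ltn_trans (leq_pred _) (ltn_ord l).
have yl : y + l%:Z = y + 1 + (Ordinal lt_l)%:Z.
  by rewrite /= -addrA -PoszD add1n prednK.
transitivity ((K *m solid_mx d (x + 1) (y + 1)) i (Ordinal lt_l)).
  by rewrite /K mulmxKV // mxE -yl.
by rewrite !mxE; apply: eq_bigr => r _; rewrite !mxE yl.
Qed.

Lemma int_shift_const (T : Type) (f : int -> T) :
  (forall x, f (x + 1) = f x) -> forall x, f x = f 0.
Proof.
move=> step; elim/int_rec => [//|k IHk|k IHk].
  by rewrite -[k.+1]addn1 PoszD step.
by rewrite -step -IHk -addn1 PoszD opprD subrK.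
Qed.

Lemma solid_mx_transfer : exists2 K : int -> 'M[F]_d,
  forall x y, solid_mx d x y = K x *m solid_mx d (x + 1) y & forall x, \det (K x) = 1.
Proof.
pose G x y := solid_mx d x y *m invmx (solid_mx d (x + 1) y).
have GS x y : G x (y + 1) = G x y by rewrite /G [in RHS]solid_mx_step mulmxK.
exists (fun x => G x 0) => [x y|x].
  by rewrite -(int_shift_const (GS x) y) mulmxKV.
by rewrite det_mulmx det_inv -!/(solid_minor _ _ _) !minor_d invr1 mulr1.
Qed.

Lemma solid_minor_recurrence n : (forall x y, a (x + n%:Z) y = a x (y + n%:Z)) ->
  forall j, (j <= d)%N -> exists2 q : {poly F}, q`_('C(d, j)) = 1 &
  forall x y, \sum_(s < 'C(d, j).+1)
    q`_s * solid_minor j (x + (n * s)%N%:Z) (y + (n * s)%N%:Z) = 0.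
Proof.
move=> period j le_jd; have [K stepK detK] := solid_mx_transfer.
have unitK x : K x \in unitmx by rewrite unitmxE detK unitr1.
pose H x := solid_mx d x n%:Z *m invmx (solid_mx d x 0).
have period_mx x y : solid_mx d (x + n%:Z) y = solid_mx d x (y + n%:Z).
  by apply/matrixP=> i l; rewrite !mxE addrAC period addrAC.
have HE x y : solid_mx d x (y + n%:Z) = H x *m solid_mx d x y.
  (* [P] is the product K(x) K(x+1) .. K(x+n-1). With the period it gives A(x,y) = P A(x,y+n), so
     [H x] is the inverse of [P], whatever [y]. *)
  have [P unitP PE] : exists2 P : 'M[F]_d, P \in unitmx &
      forall y, solid_mx d x y = P *m solid_mx d (x + n%:Z) y.
    elim: n {period H period_mx} => [|k [P uP PE]].
      by exists 1%:M => [|z]; rewrite ?unitmx1 ?addr0 ?mul1mx.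
    exists (P *m K (x + k%:Z)) => [|z]; first by rewrite unitmx_mul uP unitK.
    by rewrite PE stepK mulmxA -addrA -PoszD addn1.
  have shiftE z : solid_mx d x (z + n%:Z) = invmx P *m solid_mx d x z.
    by rewrite (PE z) period_mx mulKmx.
  have -> : H x = invmx P by rewrite /H -[n%:Z]add0r shiftE mulmxK.
  exact: shiftE.
clearbody H.
(* Both products carry A(x+1,0) to A(x,n). *)
have HK x : H x *m K x = K x *m H (x + 1).
  apply: (can_inj (mulmxK (unit_d (x + 1) 0))); rewrite -!mulmxA -stepK -!HE.
  by rewrite -stepK.
pose W x := H x *m H x.
(* By [HK], [W x] and [W (x + 1)] are conjugate under [K x], hence so are their compounds; one
   polynomial thus serves every [x]. *)
have charW x : char_poly (compound j (W (x + 1))) = char_poly (compound j (W x)).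
  have -> : W x = K x *m W (x + 1) *m invmx (K x).
    apply: (can_inj (mulmxK (unitK x))); rewrite mulmxKV //.
    by rewrite /W -mulmxA HK !mulmxA HK.
  rewrite !compoundM char_poly_similar // -compoundM mulVmx // compound1 //.
pose q := char_poly (compound j (W 0)).
exists q => [|x y].
  have /monicP := char_poly_monic (compound j (W 0)).
  by rewrite lead_coefE size_char_poly -card_jset.
have q_x : char_poly (compound j (W x)) = q by apply: (int_shift_const charW).
(* By the period, the diagonal shift by (ns, ns) amounts to a shift by 2ns in [y] alone, that is,
   [s] applications of [W x]. *)
pose B s := solid_mx d x (y + (2 * n * s)%N%:Z).
have stepB s : B s.+1 = W x *m B s.
  rewrite /B /W -mulmxA -!HE; congr solid_mx; rewrite mulnS mul2n -addnn !PoszD; ring.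
have f_inj : injective (widen_ord le_jd).
  by move=> i k /(congr1 (@nat_of_ord d)) eq_ik; apply: val_inj.
have := compound_recurrence (widen_ord le_jd) f_inj stepB; rewrite q_x => rec0.
rewrite -[RHS]rec0; apply: eq_bigr => s _; congr (_ * _).
have period_ns k u v : a (u + (n * k)%N%:Z) v = a u (v + (n * k)%N%:Z).
  elim: k u v => [|k IHk] u v; first by rewrite muln0 !addr0.
  by rewrite mulnS PoszD !addrA IHk period addrAC.
congr (\det _); apply/matrixP=> i l; rewrite !mxE /= addrAC period_ns.
congr (a _ _); rewrite mul2n -addnn mulnDl PoszD; ring.
Qed.

End RankRecurrence.

End Dodgson.

(** * Solutions of the octahedron recurrence as solid minors *)

Section Octahedron.
Variables (F : fieldType) (d n : nat) (t : nat -> int -> int -> F).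
Hypotheses (d_gt0 : (0 < d)%N)
  (t_bottom : forall x y, t 0 x y = 1) (t_top : forall x y, t d x y = 1)
  (t_neq0 : forall i x y, (i <= d)%N -> t i x y != 0)
  (octahedron : forall i x y, (0 < i < d)%N ->
     t i x y * t i (x + 1) (y + 1) =
     t i.-1 (x + 1) (y + 1) * t i.+1 x y + t i (x + 1) y * t i x (y + 1))
  (t_period : forall x y, t 1 (x + n%:Z) y = t 1 x (y + n%:Z)).

(** Desnanot-Jacobi is the octahedron relation for minors; both determine level i + 2 from levels i
    and i + 1, as level i does not vanish. *)
Lemma octahedron_minor i x y : (i <= d)%N -> t i x y = solid_minor (t 1) i x y.
Proof.
elim/ltn_ind: i x y => -[|[|i]] IH x y le_id.
- by rewrite t_bottom /solid_minor det_mx00.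
- by rewrite /solid_minor det_mx11 mxE !addr0.
have le_i : (i <= d)%N by apply: leq_trans le_id; rewrite -addn2 leq_addr.
have nz : solid_minor (t 1) i (x + 1) (y + 1) != 0 by rewrite -IH ?t_neq0 // ltnW.
apply: (mulIf nz); rewrite Desnanot_Jacobi //.
rewrite -!IH ?(ltnW le_id) // octahedron //= [_ * t i.+2 _ _]mulrC; ring.
Qed.

(** Desnanot-Jacobi at the top: times a nonzero minor of size d - 1, this minor is 1 - 1. *)
Lemma octahedron_minor_top x y : solid_minor (t 1) d.+1 x y = 0.
Proof.
case: d d_gt0 t_top t_neq0 octahedron_minor => // k _ top nz0 minorE.
have nz : solid_minor (t 1) k (x + 1) (y + 1) != 0 by rewrite -minorE ?nz0.
apply: (mulIf nz); rewrite Desnanot_Jacobi // mul0r -!minorE // !top; ring.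
Qed.

Theorem octahedron_recurrence j : (j <= d)%N ->
  exists2 q : {poly F}, q`_('C(d, j)) = 1 &
  forall x y, \sum_(s < 'C(d, j).+1)
    q`_s * t j (x + (n * s)%N%:Z) (y + (n * s)%N%:Z) = 0.
Proof.
move=> le_jd.
have minor_d x y : solid_minor (t 1) d x y = 1 by rewrite -octahedron_minor ?t_top.
have [q q1 rec_q] := solid_minor_recurrence minor_d octahedron_minor_top t_period le_jd.
exists q => // x y; rewrite -[RHS](rec_q x y).
by apply: eq_bigr => s _; rewrite octahedron_minor.
Qed.
End Octahedron.

(** * Mutation of box products *)

Section IndependentMutation.
Variables (V : finType) (F : fieldType).
Implicit Types (b : arrows V) (x : V -> F) (s : seq V).

Definition exchange b x v : F := \prod_y x y ^+ b y v + \prod_y x y ^+ b v y.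

(** Vertices of [s] are pairwise non-adjacent, so their mutations do not interfere. Arrows at [s]
    are reversed; between other vertices the paths through [s] are added, followed by
    cancellation. *)
Lemma foldl_mutate s b x :
    uniq s -> (forall u v, (b u v * b v u = 0)%N) ->
    {in s &, forall u v, b u v = 0%N} ->
  (forall v, (foldl (@mutate V F) (b, x) s).2 v =
     if v \in s then exchange b x v / x v else x v) /\
  (forall u v, (foldl (@mutate V F) (b, x) s).1 u v =
     if (u \in s) || (v \in s) then b v u
     else (b u v + \sum_(z <- s) b u z * b z v
           - (b v u + \sum_(z <- s) b v z * b z u))%N).
Proof.
elim: s b x => [|z s IHs] b x /=.
  move=> _ b2 _; split=> // u v; rewrite !big_nil.
  by have := b2 u v; case: (b u v) (b v u) => [|?] [|?] //; lia.
case/andP=> z_s uniq_s b2 b_indep.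
set b1 := mutate_quiver z b; set x1 := mutate_vars z b x.
have bzz : b z z = 0%N by have := b2 z z; lia.
have b2' u v : b u v = 0%N \/ b v u = 0%N.
  by have /eqP := b2 u v; rewrite muln_eq0 => /orP[] /eqP; [left|right].
have zin : z \in z :: s by rewrite mem_head.
have sin u : u \in s -> u \in z :: s by rewrite inE orbC => ->.
(* Mutation at [z] leaves the arrows at the remaining vertices of [s] unchanged. *)
have b1_row u v : u \in s -> b1 u v = b u v /\ b1 v u = b v u.
  move=> us; have ne_uz : u != z by apply: contraNneq z_s => <-.
  rewrite /b1 /mutate_quiver /cancel_2cycles /reverse_at /compose_at (negPf ne_uz) /=.
  rewrite !(b_indep _ _ (sin _ us) zin) !(b_indep _ _ zin (sin _ us)).
  case: eqP => [->|_]; last first.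
    rewrite orbF !mul0n !muln0 !addn0.
    by case: (b2' u v) => ->; rewrite !(subn0, sub0n).
  by rewrite !(b_indep _ _ (sin _ us) zin) !(b_indep _ _ zin (sin _ us)) bzz.
have b1_z v : b1 z v = b v z /\ b1 v z = b z v.
  rewrite /b1 /mutate_quiver /cancel_2cycles /reverse_at /compose_at eqxx orbT /= bzz.
  by case: (b2' v z) => ->; lia.
have b12 u v : (b1 u v * b1 v u = 0)%N by rewrite /b1 /mutate_quiver /cancel_2cycles; nia.
have b1_indep : {in s &, forall u v, b1 u v = 0%N}.
  by move=> u v us vs; have [-> _] := b1_row u v us; apply: b_indep; apply: sin.
have [IHx IHb] := IHs b1 x1 uniq_s b12 b1_indep; split=> [v|u v].
  rewrite IHx inE; have [vs|v_s] := boolP (v \in s).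
    have ne_vz : v != z by apply: contraNneq z_s => <-.
    rewrite orbT [x1 v]/x1 /mutate_vars (negPf ne_vz); congr (_ / _).
    have x1E y k : (y = z -> k = 0%N) -> x1 y ^+ k = x y ^+ k.
      by rewrite /x1 /mutate_vars; case: eqP => // -> /(_ erefl) ->; rewrite !expr0.
    congr (_ + _); apply: eq_bigr => y _; have [b1E b1E'] := b1_row v y vs.
      by rewrite b1E' x1E // => ->; apply: b_indep => //; apply: sin.
    by rewrite b1E x1E // => ->; apply: b_indep => //; apply: sin.
  by rewrite orbF /x1 /mutate_vars; case: eqP => // ->.
rewrite IHb !inE; have [us|u_s] := boolP (u \in s).
  by rewrite orbT; have [_ ->] := b1_row u v us.
have [vs|v_s] := boolP (v \in s).
  by rewrite !orbT; have [-> _] := b1_row v u vs.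
rewrite !orbF.
have sum1 w w' : (\sum_(t <- s) b1 w t * b1 t w' = \sum_(t <- s) b w t * b t w')%N.
  rewrite !big_seq; apply: eq_bigr => t ts.
  by have [_ ->] := b1_row t w ts; have [-> _] := b1_row t w' ts.
rewrite !sum1 !big_cons.
have sumz w : (\sum_(t <- s) b z t * b t w = 0)%N
    /\ (\sum_(t <- s) b w t * b t z = 0)%N.
  split; rewrite big_seq big1 // => t ts.
    by rewrite b_indep //; apply: sin.
  by rewrite (b_indep t z) ?muln0 //; apply: sin.
have [->|ne_uz] := eqVneq u z.
  have [-> ->] := sumz v; have [-> ->] := b1_z v.
  by case: (b2' z v) => -> /=; lia.
have [->|ne_vz] := eqVneq v z.
  have [-> ->] := sumz u; have [-> ->] := b1_z u.
  by rewrite orbT; case: (b2' z u) => ->; lia.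
(* Cancelling at [z] before adding further paths is harmless: the truncated counts in the two
   directions keep the difference of the full counts. *)
rewrite /b1 /mutate_quiver /cancel_2cycles /reverse_at /compose_at.
rewrite (negPf ne_uz) (negPf ne_vz) /=. lia.
Qed.

End IndependentMutation.

(** * Bipartite mutation of a box product *)

Section BoxMutation.
Variables (T T' : finType) (e : T -> T -> nat) (e' : T' -> T' -> nat).
Variables (c : T -> bool) (c' : T' -> bool).
Hypotheses (e_sym : forall i i', e i i' = e i' i) (e'_sym : forall i i', e' i i' = e' i' i).
Hypotheses (hc : is_bipartition e c) (hc' : is_bipartition e' c').

Local Notation V := (T * T')%type.

Let e_mono i i' : c i = c i' -> e i i' = 0%N.
Proof. by move=> eq_c; apply/eqP; rewrite -leqn0 leqNgt; apply/negP=> /hc/eqP. Qed.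

Let e'_mono i i' : c' i = c' i' -> e' i i' = 0%N.
Proof. by move=> eq_c; apply/eqP; rewrite -leqn0 leqNgt; apply/negP=> /hc'/eqP. Qed.

(** Arrows leaving a black vertex run along the first factor, those leaving a white vertex along the
    second. *)
Lemma box_arrowsE (u v : V) : box_arrows e e' c c' u v =
  if c u.1 == c' u.2 then ((u.2 == v.2) * e u.1 v.1)%N else ((u.1 == v.1) * e' u.2 v.2)%N.
Proof.
case: u v => [i p] [i' p']; rewrite /box_arrows /box_edges /box_class /=.
have [<-|ne_i] := eqVneq i i'; have [<-|ne_p] := eqVneq p p';
  rewrite ?mul1n ?mul0n ?addn0 ?(e_mono (erefl (c i))) ?(e'_mono (erefl (c' p)));
  do ?[by case: (c i); case: (c' p)].
- have := @e'_mono p p'.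
  by case: (c i); case: (c' p); case: (c' p') => //= ->.
- have := @e_mono i i'.
  by case: (c i); case: (c' p); case: (c i') => //= ->.
by rewrite !if_same.
Qed.

(** Free of orientation, so it serves black and white vertices and the reversed quiver alike. *)
Definition box_exchange (F : fieldType) (x : V -> F) (v : V) : F :=
  \prod_i x (i, v.2) ^+ e i v.1 + \prod_p x (v.1, p) ^+ e' p v.2.

Definition box_mutation (F : fieldType) (P : {pred V}) (x : V -> F) (v : V) : F :=
  if v \in P then box_exchange x v / x v else x v.

Let prod_row (F : fieldType) (x : V -> F) i (k : T' -> nat) :
  \prod_(y : V) x y ^+ ((y.1 == i) * k y.2) = \prod_p x (i, p) ^+ k p.
Proof.
transitivity (\prod_j \prod_p x (j, p) ^+ ((j == i) * k p)).
  by rewrite pair_bigA; apply: eq_bigr => -[].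
rewrite (bigD1 i) //=.
rewrite [X in _ * X]big1 ?mulr1 => [|j /negPf ne_j].
  by apply: eq_bigr => p _; rewrite eqxx mul1n.
by rewrite big1 // => p _; rewrite ne_j mul0n.
Qed.

Let prod_col (F : fieldType) (x : V -> F) p (k : T -> nat) :
  \prod_(y : V) x y ^+ ((y.2 == p) * k y.1) = \prod_i x (i, p) ^+ k i.
Proof.
transitivity (\prod_i \prod_q x (i, q) ^+ ((q == p) * k i)).
  by rewrite pair_bigA; apply: eq_bigr => -[].
apply: eq_bigr => i _.
rewrite (bigD1 p) //= eqxx mul1n big1 ?mulr1 // => q /negPf ne_q.
by rewrite ne_q mul0n.
Qed.

Lemma exchange_box (F : fieldType) (x : V -> F) v :
  exchange (box_arrows e e' c c') x v = box_exchange x v.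
Proof.
rewrite /exchange /box_exchange -prod_row -prod_col.
have [black_v|white_v] := boolP (c v.1 == c' v.2).
  rewrite addrC; congr (_ + _); apply: eq_bigr => y _; congr (_ ^+ _).
    by rewrite box_arrowsE black_v eq_sym e_sym.
  rewrite box_arrowsE; case: ifP => // black_y.
  have [eq1|] := eqVneq y.1 v.1; have [eq2|] := eqVneq y.2 v.2; rewrite ?mul0n //.
  - by rewrite e_mono ?eq1 // e'_mono ?eq2.
  - rewrite e'_mono //.
    by move: black_y; rewrite eq1 (eqP black_v) => /eqP.
  - by rewrite e_mono // (eqP black_y) eq2 (eqP black_v).
congr (_ + _); apply: eq_bigr => y _; congr (_ ^+ _); last first.
  by rewrite box_arrowsE (negPf white_v) eq_sym e'_sym.
rewrite box_arrowsE; case: ifP => // white_y.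
have [eq1|] := eqVneq y.1 v.1; have [eq2|] := eqVneq y.2 v.2; rewrite ?mul0n //.
- by rewrite e_mono ?eq1 // e'_mono ?eq2.
- rewrite e'_mono //.
  by move: white_y white_v; rewrite eq1; case: (c v.1); case: (c' y.2); case: (c' v.2).
- rewrite e_mono //.
  by move: white_y white_v; rewrite eq2; case: (c v.1); case: (c y.1); case: (c' v.2).
Qed.

Let box_arrows2 u v : (box_arrows e e' c c' u v * box_arrows e e' c c' v u = 0)%N.
Proof.
rewrite !box_arrowsE; have [eq1|ne1] := eqVneq u.1 v.1.
  rewrite eq1 (e_mono (erefl _)) !muln0 !mul1n.
  case: (boolP (c v.1 == c' u.2)) => cu; case: (boolP (c v.1 == c' v.2)) => cv;
    rewrite ?muln0 ?mul0n // e'_mono //.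
  by move: cu cv; case: (c v.1); case: (c' u.2); case: (c' v.2).
rewrite !mul0n.
case: (boolP (c u.1 == c' u.2)) => cu; case: (boolP (c v.1 == c' v.2)) => cv;
  rewrite ?muln0 ?mul0n //.
by have [eq2|] := eqVneq u.2 v.2; rewrite // e_mono ?muln0 // (eqP cu) (eqP cv) eq2.
Qed.

Let black_indep u v : c u.1 == c' u.2 -> c v.1 == c' v.2 -> box_arrows e e' c c' u v = 0%N.
Proof.
move=> cu cv; rewrite box_arrowsE cu; case: eqP => [eq2|]; rewrite ?mul0n //.
by rewrite e_mono // (eqP cu) (eqP cv) eq2.
Qed.

Let white_indep u v : c u.1 != c' u.2 -> c v.1 != c' v.2 -> box_arrows e e' c c' u v = 0%N.
Proof.
move=> cu cv; rewrite box_arrowsE (negPf cu); case: eqP => [eq1|]; rewrite ?mul0n //.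
rewrite e'_mono //; move: cu cv; rewrite eq1.
by case: (c v.1); case: (c' u.2); case: (c' v.2).
Qed.

Lemma mu_plus_box (F : fieldType) (x : V -> F) :
  let s := mu_plus c c' (box_arrows e e' c c', x) in
  s.2 =1 box_mutation (black c c') x /\
  forall u v, s.1 u v = box_arrows e e' c c' v u.
Proof.
rewrite /mu_plus /mutate_all.
have [|x' b'] := foldl_mutate x (enum_uniq (black c c')) box_arrows2.
- by move=> u v; rewrite !mem_enum; apply: black_indep.
split=> [v|u v].
  by rewrite x' mem_enum exchange_box.
rewrite b' !mem_enum; case: ifPn => // /norP[white_u white_v].
(* A two-step path from a white [w] to [w'] through a black vertex turns at (w.1, w'.2). The number
   of such paths is symmetric between white vertices, so the added arrows cancel. *)
have sumE w w' : c w.1 != c' w.2 -> (\sum_(z <- enum (black c c'))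
    box_arrows e e' c c' w z * box_arrows e e' c c' z w' = e' w.2 w'.2 * e w.1 w'.1)%N.
  move=> white_w; rewrite big_enum big_mkcond /=.
  transitivity (\sum_(z : V) (w.1 == z.1) * e' w.2 z.2 * ((z.2 == w'.2) * e z.1 w'.1))%N.
    apply: eq_bigr => z _; rewrite !box_arrowsE (negPf white_w).
    rewrite (_ : (z \in black c c') = (c z.1 == c' z.2)) //.
    case: (boolP (c z.1 == c' z.2)) => // white_z.
    have [eq1|] := eqVneq w.1 z.1; rewrite ?mul0n //.
    rewrite e'_mono ?muln0 ?mul0n //; move: white_w white_z; rewrite eq1.
    by case: (c z.1); case: (c' w.2); case: (c' z.2).
  rewrite (bigD1 (w.1, w'.2)) //= !eqxx !mul1n big1 ?addn0 // => z.
  have [eq1|] := eqVneq w.1 z.1; rewrite ?mul0n //.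
  have [eq2|] := eqVneq z.2 w'.2; rewrite ?mul0n ?muln0 //.
  by case: z eq1 eq2 => z1 z2 /= -> ->; rewrite eqxx.
by rewrite !sumE // white_indep // white_indep // e_sym e'_sym subnn.
Qed.

(** After [mu_plus] the quiver is reversed, which affects neither the independence of the white
    vertices nor the exchange sum. *)
Lemma new_varE (C : fieldType) v : new_var C e e' c c' v =
  box_mutation (white c c') (box_mutation (black c c') (@ratX C V)) v.
Proof.
rewrite /new_var /initial_seed.
have [] := mu_plus_box (@ratX C V).
case: (mu_plus c c' _) => b x /= x_eq b_eq.
rewrite /mu_minus /mutate_all.
have [||x' _] := foldl_mutate (b := b) x (enum_uniq (white c c')).
- by move=> u w; rewrite !b_eq mulnC box_arrows2.
- by move=> u w; rewrite !mem_enum b_eq => wu ww; apply: white_indep.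
rewrite x' mem_enum /box_mutation -/(box_mutation (black c c') _ v) x_eq.
case: ifP => // _; congr (_ / _); rewrite -exchange_box /exchange addrC.
by congr (_ + _); apply: eq_bigr => y _; rewrite b_eq x_eq.
Qed.

End BoxMutation.

(** * Substitutions in rational function fields *)

Section FractionLift.
Variable R : idomainType.
Local Notation tofrac := (@tofrac R).

Lemma frac_numden (x : {fraction R}) :
  x = tofrac \n_(repr x) / tofrac \d_(repr x).
Proof.
rewrite -{1}[x]reprK; move: (repr x) => r.
have nz : tofrac \d_r != 0 by rewrite tofrac_eq0 denom_ratioP.
apply: (mulIf nz); rewrite divfK //.
unlock FracField.tofrac; rewrite -[LHS]FracField.pi_mul.
apply/eqmodP; rewrite /= FracField.equivfE /FracField.mulf.
by rewrite !numden_Ratio ?(mulf_neq0, oner_neq0, denom_ratioP) // !mulr1 mulrC.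
Qed.

Lemma fracP (x : {fraction R}) :
  exists p q : R, q != 0 /\ x = tofrac p / tofrac q.
Proof. by exists \n_(repr x), \d_(repr x); rewrite -frac_numden denom_ratioP. Qed.

Section Lift.
Variables (L : fieldType) (f : {rmorphism R -> L}).
Hypothesis f_inj : forall p, f p = 0 -> p = 0.

(** Defined on a chosen representative; [liftE] shows that any other gives the same value. *)
Let lift (x : {fraction R}) : L := f \n_(repr x) / f \d_(repr x).

Let f_neq0 q : q != 0 -> f q != 0.
Proof. by apply: contra_neq => /f_inj. Qed.

Let liftE p q : q != 0 -> lift (tofrac p / tofrac q) = f p / f q.
Proof.
move=> nz_q; set x := tofrac p / tofrac q; rewrite /lift.
have nz_d : \d_(repr x) != 0 by apply: denom_ratioP.
apply/eqP; rewrite eqr_div ?f_neq0 // -!rmorphM; apply/eqP; congr (f _).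
apply/eqP; rewrite -tofrac_eq !tofracM -eqr_div ?tofrac_eq0 //; apply/eqP.
by rewrite -frac_numden.
Qed.

Let lift_zmod : zmod_morphism lift.
Proof.
move=> x y; have [p [q [nz_q ->]]] := fracP x; have [p' [q' [nz_q' ->]]] := fracP y.
rewrite -mulNr -tofracN addf_div ?tofrac_eq0 // -!tofracM -tofracD.
rewrite !liftE ?mulf_neq0 // -mulNr -rmorphN addf_div ?f_neq0 //.
by rewrite !(rmorphM, rmorphD).
Qed.

Let lift_monoid : monoid_morphism lift.
Proof.
split=> [|x y].
  by rewrite -(divr1 1) -tofrac1 liftE ?oner_neq0 // rmorph1 divr1.
have [p [q [nz_q ->]]] := fracP x; have [p' [q' [nz_q' ->]]] := fracP y.
by rewrite mulf_div -!tofracM !liftE ?mulf_neq0 // mulf_div !rmorphM.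
Qed.

HB.instance Definition _ := GRing.isZmodMorphism.Build {fraction R} L lift lift_zmod.
HB.instance Definition _ := GRing.isMonoidMorphism.Build {fraction R} L lift lift_monoid.

Lemma frac_lift : exists g : {rmorphism {fraction R} -> L}, forall p, g (tofrac p) = f p.
Proof.
exists lift => p.
by rewrite /= -[tofrac p]divr1 -tofrac1 liftE ?oner_neq0 // rmorph1 divr1.
Qed.
End Lift.

Lemma frac_rmorph_eq (L : fieldType) (f g : {rmorphism {fraction R} -> L}) :
  (forall p, f (tofrac p) = g (tofrac p)) -> f =1 g.
Proof. by move=> fg x; have [p [q [_ ->]]] := fracP x; rewrite !fmorph_div !fg. Qed.

End FractionLift.

Lemma mpoly_ring_ind n (R : comNzRingType) (Q : {mpoly R[n]} -> Prop) :
    (forall a, Q a%:MP) -> (forall i, Q 'X_i) ->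
    (forall p q, Q p -> Q q -> Q (p + q)) -> (forall p q, Q p -> Q q -> Q (p * q)) ->
  forall p, Q p.
Proof.
move=> QC QX QD QM p; rewrite [p]mpolyE.
have Q0 : Q 0 by rewrite -mpolyC0; apply: QC.
have Q1 : Q 1 by rewrite -mpolyC1; apply: QC.
apply: (big_ind Q Q0 QD) => m _; rewrite -mul_mpolyC; apply: (QM) => //.
rewrite mpolyXE_id; apply: (big_ind Q Q1 QM) => i _.
by elim: (m i) => [|k IHk]; rewrite ?expr0 // exprS; apply: (QM).
Qed.

(** * Involutive substitutions of variables *)

Section Substitution.
Variables (C : fieldType) (V : finType).
Local Notation F := (ratfun C V).
Local Notation mpol := {mpoly C[#|V|]}.
Implicit Types (z : V -> F) (p : mpol).

Definition ratfun_eval z : mpol -> F :=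
  mmap (@tofrac mpol \o @mpolyC #|V| C) (fun i => z (enum_val i)).

HB.instance Definition _ z := GRing.RMorphism.copy (ratfun_eval z)
  (mmap (@tofrac mpol \o @mpolyC #|V| C) (fun i => z (enum_val i))).

Lemma ratfun_evalC z a : ratfun_eval z a%:MP = ratC V a.
Proof. exact: mmapC. Qed.

Lemma ratfun_evalX z v : ratfun_eval z 'X_(enum_rank v) = z v.
Proof. by rewrite /ratfun_eval mmapX mmap1U enum_rankK. Qed.

Lemma mpoly_rmorph_eq (L : fieldType) (f g : {rmorphism mpol -> L}) :
    (forall a, f a%:MP = g a%:MP) ->
    (forall v, f 'X_(enum_rank v) = g 'X_(enum_rank v)) -> f =1 g.
Proof.
move=> fgC fgX; apply: mpoly_ring_ind => [//|i|p q fp fq|p q fp fq].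
- by rewrite -(enum_valK i).
- by rewrite !rmorphD fp fq.
- by rewrite !rmorphM fp fq.
Qed.

Lemma ratfun_eval_ratX p : ratfun_eval (@ratX C V) p = tofrac p.
Proof.
apply: (mpoly_rmorph_eq (f := ratfun_eval (@ratX C V)) (g := @tofrac mpol)) => [a|v].
  exact: ratfun_evalC.
exact: ratfun_evalX.
Qed.

Lemma eq_ratfun_eval z z' p : z =1 z' -> ratfun_eval z p = ratfun_eval z' p.
Proof.
move=> eqz; apply: (mpoly_rmorph_eq (f := ratfun_eval z) (g := ratfun_eval z')) => [a|v].
  by rewrite /= !ratfun_evalC.
by rewrite /= !ratfun_evalX eqz.
Qed.

Lemma rmorph_ratfun_eval (f : {rmorphism F -> F}) z p :
  (forall a, f (ratC V a) = ratC V a) ->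
  f (ratfun_eval z p) = ratfun_eval (f \o z) p.
Proof.
move=> fC; apply: (mpoly_rmorph_eq (f := f \o ratfun_eval z)
  (g := ratfun_eval (f \o z))) => [a|v] /=.
  by rewrite !ratfun_evalC fC.
by rewrite !ratfun_evalX.
Qed.

Lemma ratfun_rmorph_eq (L : fieldType) (f g : {rmorphism F -> L}) :
    (forall a, f (ratC V a) = g (ratC V a)) ->
    (forall v : V, f (ratX C v) = g (ratX C v)) -> f =1 g.
Proof.
move=> fgC fgX; apply: frac_rmorph_eq.
exact: (mpoly_rmorph_eq (f := f \o @tofrac mpol) (g := g \o @tofrac mpol)).
Qed.

Lemma ratX_neq0 (v : V) : ratX C v != 0.
Proof.
rewrite /ratX tofrac_eq0; apply/eqP=> /(congr1 (meval (fun=> 1)))/eqP.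
by rewrite mevalXU meval0 oner_eq0.
Qed.

Variables (P : {pred V}) (N : V -> mpol).
Hypothesis N_neq0 : forall v, v \in P -> N v != 0.
Hypothesis N_free : forall v z z', v \in P -> (forall u, u \notin P -> z u = z' u) ->
  ratfun_eval z (N v) = ratfun_eval z' (N v).

(** The substitution acts here on points [z], so that it can be iterated before it is known to
    extend to the field. *)
Let sigma z v : F := if v \in P then ratfun_eval z (N v) / z v else z v.

Let sigma_N v z : v \in P -> ratfun_eval (sigma z) (N v) = ratfun_eval z (N v).
Proof. by move=> Pv; apply: N_free => // u Pu; rewrite /sigma (negPf Pu). Qed.

Let X := @ratX C V.

Let NX_neq0 v : v \in P -> ratfun_eval X (N v) != 0.
Proof. by move=> Pv; rewrite ratfun_eval_ratX tofrac_eq0 N_neq0. Qed.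

Let sigmaK : sigma (sigma X) =1 X.
Proof.
move=> v; rewrite {1}/sigma; case: ifP => Pv; last by rewrite /sigma Pv.
by rewrite sigma_N // /sigma Pv invf_div mulrCA divff ?mulr1 // NX_neq0.
Qed.

Let D z : F := \prod_(v in P) z v.

(* At z = X this shows that g = 0 whenever p vanishes at sigma X; at z = sigma X it
   then shows that p vanishes at sigma (sigma X) = X. *)
Let clear_denominators p : exists g d, forall z, (forall v, v \in P -> z v != 0) ->
  ratfun_eval z g = D z ^+ d * ratfun_eval (sigma z) p.
Proof.
elim/mpoly_ring_ind: p => [a|i|p q [g [d Hg]] [h [k Hh]]|p q [g [d Hg]] [h [k Hh]]].
- by exists a%:MP, 0%N => z _; rewrite mul1r !ratfun_evalC.
- rewrite -(enum_valK i); move: (enum_val i) => v.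
  have [Pv|/negPf Pv] := boolP (v \in P); last first.
    by exists 'X_(enum_rank v), 0%N => z _; rewrite mul1r !ratfun_evalX /sigma Pv.
  exists (N v * \prod_(u in P | u != v) 'X_(enum_rank u)), 1%N => z nz.
  have -> : D z = z v * \prod_(u in P | u != v) z u by rewrite /D (bigD1 v).
  rewrite expr1 ratfun_evalX rmorphM rmorph_prod /= /sigma Pv.
  rewrite [z v * _]mulrC -mulrA [z v * _]mulrC divfK ?nz // mulrC; congr (_ * _).
  by apply: eq_bigr => u _; rewrite /= ratfun_evalX.
- pose Dp : mpol := \prod_(v in P) 'X_(enum_rank v).
  have DpE z : ratfun_eval z Dp = D z.
    by rewrite rmorph_prod; apply: eq_bigr => v _; rewrite /= ratfun_evalX.
  exists (g * Dp ^+ k + h * Dp ^+ d), (d + k)%N => z nz.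
  rewrite !(rmorphD, rmorphM, rmorphXn) /= !DpE Hg // Hh // exprD; ring.
- exists (g * h), (d + k)%N => z nz.
  by rewrite !rmorphM /= Hg // Hh // exprD mulrACA.
Qed.

(** This allows evaluation at [sigma X] to extend to fractions. *)
Let sigma_eval_inj p : ratfun_eval (sigma X) p = 0 -> p = 0.
Proof.
move=> p0; have [g [d Hg]] := clear_denominators p.
have g0 : g = 0.
  have : tofrac g = 0.
    rewrite -[LHS]ratfun_eval_ratX [LHS]Hg => [|v _]; last exact: ratX_neq0.
    by rewrite p0 mulr0.
  by move/eqP; rewrite tofrac_eq0 => /eqP.
have nz v : v \in P -> sigma X v != 0.
  by move=> Pv; rewrite /sigma Pv mulf_neq0 ?invr_eq0 ?NX_neq0 ?ratX_neq0.
have /esym/eqP := Hg (sigma X) nz; rewrite g0 rmorph0 mulf_eq0 expf_eq0.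
rewrite (negPf (_ : D _ != 0)) ?andbF /=; last by apply/prodf_neq0 => v /nz.
by rewrite (eq_ratfun_eval _ sigmaK) ratfun_eval_ratX tofrac_eq0 => /eqP.
Qed.

(* Composed with itself, the substitution fixes the variables outside P, hence
   N v, and then sends x_v = N v / (N v / x_v) to x_v for v in P. *)
Lemma ratfun_involution : exists phi : {rmorphism F -> F},
  [/\ forall a, phi (ratC V a) = ratC V a,
      forall v : V, phi (ratX C v) =
        if v \in P then tofrac (N v) / ratX C v else ratX C v
    & involutive phi].
Proof.
have [phi phiE] := frac_lift sigma_eval_inj.
have phiC a : phi (ratC V a) = ratC V a by rewrite [LHS]phiE [LHS]ratfun_evalC.
have phiX (v : V) : phi (ratX C v) = sigma X v by rewrite [LHS]phiE [LHS]ratfun_evalX.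
exists phi; split=> // [v|]; first by rewrite phiX /sigma ratfun_eval_ratX.
apply: (ratfun_rmorph_eq (f := phi \o phi) (g := idfun)) => [a|v] /=.
  by rewrite !phiC.
rewrite phiX {1}/sigma; case: ifP => Pv; last by rewrite phiX /sigma Pv.
rewrite fmorph_div phiX rmorph_ratfun_eval // (eq_ratfun_eval (z' := sigma X)) //.
by have := sigmaK v; rewrite {1}/sigma Pv.
Qed.

End Substitution.

(** * Existence of the bipartite map and exchange relations along its orbits *)

Section BipartiteMapRelations.
Variables (C : fieldType) (T T' : finType) (e : T -> T -> nat) (e' : T' -> T' -> nat).
Variables (c : T -> bool) (c' : T' -> bool).
Hypotheses (e_sym : forall i i', e i i' = e i' i) (e'_sym : forall i i', e' i i' = e' i' i).
Hypotheses (hc : is_bipartition e c) (hc' : is_bipartition e' c').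
Local Notation V := (T * T')%type.
Local Notation F := (ratfun C V).
Local Notation mpol := {mpoly C[#|{: V}|]}.

Lemma eq_box_exchange (L : fieldType) (x y : V -> L) v :
    (forall u, (c u.1 == c' u.2) != (c v.1 == c' v.2) -> x u = y u) ->
  box_exchange e e' x v = box_exchange e e' y v.
Proof.
move=> eq_xy; congr (_ + _); apply: eq_bigr => i _.
  have [->|/hc ne_c] := posnP (e i v.1); first by rewrite !expr0.
  by rewrite eq_xy //=; move: ne_c; case: (c i); case: (c v.1); case: (c' v.2).
have [->|/hc' ne_c] := posnP (e' i v.2); first by rewrite !expr0.
by rewrite eq_xy //=; move: ne_c; case: (c' i); case: (c v.1); case: (c' v.2).
Qed.

Lemma eq_box_mutation (L : fieldType) (P : {pred V}) (x y : V -> L) v :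
  x =1 y -> box_mutation e e' P x v = box_mutation e e' P y v.
Proof.
move=> eq_xy; rewrite /box_mutation eq_xy; case: ifP => // _; congr (_ / _).
exact: eq_box_exchange.
Qed.

Lemma rmorph_box_exchange (L L' : fieldType) (f : {rmorphism L -> L'}) (x : V -> L) v :
  f (box_exchange e e' x v) = box_exchange e e' (f \o x) v.
Proof.
by rewrite rmorphD !rmorph_prod; congr (_ + _); apply: eq_bigr => i _; rewrite rmorphXn.
Qed.

Lemma rmorph_box_mutation (L L' : fieldType) (f : {rmorphism L -> L'}) (P : {pred V}) x v :
  f (box_mutation e e' P x v) = box_mutation e e' P (f \o x) v.
Proof.
rewrite /box_mutation; case: ifP => // _.
by rewrite fmorph_div rmorph_box_exchange.
Qed.

Let exchange_poly (v : V) : mpol :=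
  \prod_i 'X_(enum_rank (i, v.2)) ^+ e i v.1 + \prod_p 'X_(enum_rank (v.1, p)) ^+ e' p v.2.

Let eval_exchange_poly (z : V -> F) v :
  ratfun_eval z (exchange_poly v) = box_exchange e e' z v.
Proof.
rewrite rmorphD !rmorph_prod; congr (_ + _); apply: eq_bigr => i _;
  by rewrite rmorphXn /= ratfun_evalX.
Qed.

Let tofrac_exchange_poly v :
  tofrac (exchange_poly v) = box_exchange e e' (@ratX C V) v.
Proof. by rewrite -[LHS]ratfun_eval_ratX [LHS]eval_exchange_poly. Qed.

(** Its value with all variables set to 1 is 2. *)
Let exchange_poly_neq0 v : (2%:R : C) != 0 -> exchange_poly v != 0.
Proof.
apply: contra_neq => /(congr1 (meval (fun=> 1))); rewrite meval0 => <-.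
rewrite rmorphD !rmorph_prod /= !big1 // => i _; by rewrite rmorphXn /= mevalXU expr1n.
Qed.

(** As [P] has a single colour, the exchange polynomials at its vertices involve only variables
    outside [P]. *)
Lemma box_mutation_involution (P : {pred V}) :
    (2%:R : C) != 0 ->
    {in P &, forall u v, (c u.1 == c' u.2) = (c v.1 == c' v.2)} ->
  exists phi : {rmorphism F -> F},
  [/\ forall a, phi (ratC V a) = ratC V a,
      forall v : V, phi (ratX C v) = box_mutation e e' P (@ratX C V) v
    & involutive phi].
Proof.
move=> nz2 P_mono.
have [|v z z' Pv eq_z|phi [phiC phiX phiK]] :=
    @ratfun_involution C V P exchange_poly.
- by move=> v _; apply: exchange_poly_neq0.
- rewrite [LHS]eval_exchange_poly [RHS]eval_exchange_poly.
  apply: eq_box_exchange => u; apply: contraNeq => ne_z.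
  rewrite (P_mono u v) //; apply: contraR ne_z => Pu; exact/eqP/eq_z.
exists phi; split; [exact: phiC | move=> v | exact: phiK].
rewrite phiX /box_mutation; case: ifP => _; last by [].
by rewrite tofrac_exchange_poly.
Qed.

Lemma bipartite_map_exists : (2%:R : C) != 0 ->
  exists mu : field_aut F, is_bipartite_map e e' c c' mu.
Proof.
move=> nz2.
have [|f [fC fX fK]] := @box_mutation_involution (black c c') nz2.
  by move=> u v; rewrite !inE => -> ->.
have [|g [gC gX gK]] := @box_mutation_involution (white c c') nz2.
  by move=> u v; rewrite !inE => /negPf-> /negPf->.
(* Substitutions compose in reverse order: [g] writes the white mutation in the variables, and [f]
   then replaces these by their black mutations. *)
have fgK : cancel (f \o g) (g \o f) by move=> x; rewrite /= fK gK.
have gfK : cancel (g \o f) (f \o g) by move=> x; rewrite /= gK fK.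
exists (@FieldAut _ (f \o g) _ fgK gfK); split=> [a|v] /=; first by rewrite gC fC.
rewrite new_varE // gX rmorph_box_mutation; apply: eq_box_mutation => u.
exact: fX.
Qed.

Section Powers.
Variable mu : field_aut F.

Lemma aut_pow_rmorph k : exists g : {rmorphism F -> F}, aut_pow mu k =1 g.
Proof.
have iter_rmorph (f : {rmorphism F -> F}) j : exists g : {rmorphism F -> F}, iter j f =1 g.
  elim: j => [|j [g gE]]; first by exists idfun.
  by exists (f \o g) => x /=; rewrite gE.
have [f fE] : exists f : {rmorphism F -> F}, aut_inv mu =1 f.
  have zm : zmod_morphism (aut_inv mu) := can2_zmod_morphism (aut_funK mu) (aut_invK mu).
  have mm : monoid_morphism (aut_inv mu) := can2_monoid_morphism (aut_funK mu) (aut_invK mu).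
  pose za := GRing.isZmodMorphism.Build F F (aut_inv mu) zm.
  pose ma := GRing.isMonoidMorphism.Build F F (aut_inv mu) mm.
  pose f : {rmorphism F -> F} := HB.pack (aut_inv mu) za ma.
  by exists f.
case: k => k; first exact: iter_rmorph.
have [g gE] := iter_rmorph f k.+1; exists g => x; rewrite -gE /aut_pow.
by elim: k.+1 => //= j ->.
Qed.

Lemma aut_powS k x : aut_pow mu (k + 1) x = aut_pow mu k (mu x).
Proof.
case: k => [k|[|k]].
- by rewrite -PoszD addn1 /= -iterSr.
- by rewrite /= aut_funK.
have -> : Negz k.+1 + 1 = Negz k by lia.
by rewrite /aut_pow [in RHS]iterSr aut_funK.
Qed.

Hypothesis mu_bip : is_bipartite_map e e' c c' mu.
Local Notation a k v := (aut_pow mu k (ratX C v)).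

Lemma aut_pow_neq0 k v : a k v != 0.
Proof. by have [g ->] := aut_pow_rmorph k; rewrite fmorph_eq0 ratX_neq0. Qed.

(** Black vertices mutate first and see their white neighbours at time [k]; white vertices then see
    black neighbours already at time k + 1. *)
Lemma aut_pow_exchange k (v : V) : a (k + 1) v * a k v =
  box_exchange e e' (fun u => a (if c v.1 == c' v.2 then k else k + 1) u) v.
Proof.
have muX (u : V) : mu (ratX C u) = new_var C e e' c c' u by case: mu_bip.
rewrite aut_powS muX new_varE // /box_mutation !inE.
have [g gE] := aut_pow_rmorph k; rewrite !gE.
case: (boolP (c v.1 == c' v.2)) => black_v /=.
  rewrite fmorph_div divfK ?fmorph_eq0 ?ratX_neq0 // rmorph_box_exchange.
  by apply: eq_box_exchange => u _; rewrite gE.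
rewrite fmorph_div divfK ?fmorph_eq0 ?ratX_neq0 // rmorph_box_exchange.
apply: eq_box_exchange => u; rewrite (negPf black_v) eqbF_neg negbK => black_u.
rewrite aut_powS gE muX new_varE // /box_mutation !inE black_u /=.
by rewrite (_ : u \in black c c').
Qed.
End Powers.
End BipartiteMapRelations.

(** * The T-system *)

Lemma sum_multiples (V : nmodType) (n N : nat) (f : nat -> V) : (0 < n)%N ->
  \sum_(i < n * N) (if (n %| i.+1)%N then f (i.+1 %/ n)%N else 0) =
  \sum_(s < N) f s.+1.
Proof.
case: n => // n _; elim: N => [|N IHN]; first by rewrite muln0 !big_ord0.
pose g i := if (n.+1 %| i.+1)%N then f (i.+1 %/ n.+1)%N else 0.
rewrite [RHS]big_ord_recr /= -IHN -!(big_mkord xpredT g) /g.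
rewrite mulnSr addnS (@big_cat_nat _ _ _ (n.+1 * N)) ?leqW ?leq_addr //=; congr (_ + _).
rewrite big_nat_recr ?leq_addr //= -addnS -mulnSr dvdn_mulr // mulKn //.
rewrite big_nat big1 ?add0r // => i /andP[le_i lt_i]; case: ifP => // dvd_i.
move/dvdnP: dvd_i => [l El]; suff: (N < l < N.+1)%N by rewrite ltnS ltnNge andNb.
have ltM k k' : (k < k')%N = (n.+1 * k < n.+1 * k')%N by rewrite ltn_pmul2l.
by rewrite ltM (ltM l) (mulnC _ l) -El mulnS ltnS le_i addSn ltnS addnC.
Qed.

Lemma linearizable_of_recurrence (F : fieldType) (a : int -> F) (n N : nat) (q : nat -> F) :
    (0 < n)%N -> q N = 1 ->
    (forall k, \sum_(s < N.+1) q s * a (k + (n * s)%N%:Z) = 0) ->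
  linearizable a (n * N).
Proof.
move=> n_gt0 qN rec_a.
(* The recurrence started at k - nN has top term a(k), with coefficient 1; the lag ns gets the
   coefficient -q(N - s) and all other lags get 0. *)
exists (fun i => if (n %| i.+1)%N then - q (N - i.+1 %/ n)%N else 0) => k.
have /eqP := rec_a (k - (n * N)%N%:Z).
rewrite big_ord_recr /= qN mul1r subrK addrC addr_eq0 => /eqP ->.
pose f s := - q (N - s)%N * a (k - (n * s)%N%:Z).
transitivity (\sum_(s < N) f s.+1).
  rewrite -sumrN [RHS](reindex_inj rev_ord_inj) /=; apply: eq_bigr => s _.
  have ltsN := ltn_ord s; rewrite /f mulNr; congr (- (q _ * a _)); first by lia.
  by rewrite subnSK // mulnBr -subzn ?leq_mul2l ?(ltnW ltsN) ?orbT //; ring.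
rewrite -(sum_multiples N f n_gt0); apply: eq_bigr => i _.
by case: ifP => [/divnK|_]; rewrite ?mul0r // /f mulnC => ->.
Qed.

(** * Neighbours and colours in the path and the cycle *)

Section PathCycle.
Variables (F : fieldType).

(* Levels 1 .. m are the vertices of A_m; the levels 0 and m + 1 carry 1. *)
Definition level m (f : 'I_m -> F) (i : nat) : F :=
  if i is i'.+1 then oapp f 1 (insub i') else 1.

Lemma levelS m (f : 'I_m -> F) (q : 'I_m) : level f q.+1 = f q.
Proof. by rewrite /level valK. Qed.

Lemma level_top m (f : 'I_m -> F) : level f m.+1 = 1.
Proof. by rewrite /level insubN // ltnn. Qed.

Lemma prod_pred1_exp (I : finType) (f : I -> F) (i0 : I) :
  \prod_i f i ^+ (i == i0) = f i0.
Proof.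
rewrite (bigD1 i0) //= eqxx expr1 big1 ?mulr1 // => i /negPf ->.
by rewrite expr0.
Qed.

(** Vertex [q] has level q + 1; the boundary levels stand in for the missing neighbours at the
    ends. *)
Lemma prod_pathA m (f : 'I_m -> F) (q : 'I_m) :
  \prod_i f i ^+ pathA i q = level f q * level f q.+2.
Proof.
rewrite (eq_bigr (fun i : 'I_m => f i ^+ (q == i.+1 :> nat) * f i ^+ (i == q.+1 :> nat)))
  => [|i _]; last by rewrite -exprD.
have nat_prod j : \prod_(i < m) f i ^+ (i == j :> nat) = level f j.+1.
  rewrite /level; case: insubP => [i0 _ <-|j_m] /=; first exact: prod_pred1_exp.
  rewrite big1 // => i _; rewrite (_ : (i == j :> nat) = false) ?expr0 //.
  by apply: contraNF j_m => /eqP <-.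
rewrite big_split nat_prod; congr (_ * _).
case: (nat_of_ord q) => [|j].
  by rewrite big1.
rewrite -nat_prod; apply: eq_bigr => i _; congr (_ ^+ _).
by rewrite eqSS eq_sym.
Qed.

Variable n : nat.
Hypothesis n_gt0 : (0 < n)%N.

Lemma absz_mod_lt (z : int) : (`|(z %% (2 * n)%N%:Z)%Z| < 2 * n)%N.
Proof. by have := @ltz_mod z (2 * n)%N%:Z; have := @modz_ge0 z (2 * n)%N%:Z; lia. Qed.

Definition cycle_pos (z : int) : 'I_(2 * n) := Ordinal (absz_mod_lt z).

Lemma cycle_posE z : (cycle_pos z)%:Z = (z %% (2 * n)%N%:Z)%Z.
Proof. by rewrite /= gez0_abs // modz_ge0 //; lia. Qed.

Lemma cycle_pos_ord (p : 'I_(2 * n)) : cycle_pos p = p.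
Proof. by apply: val_inj; rewrite /= modz_nat modn_small. Qed.

Lemma cycle_pos_period z : cycle_pos (z + (2 * n)%N%:Z) = cycle_pos z.
Proof. by apply: val_inj; rewrite /= modzDr. Qed.

Lemma cycle_posS z : cycle_pos (z + 1) = ordS (cycle_pos z).
Proof.
apply: val_inj; apply: (can_inj absz_nat); rewrite cycle_posE /= -modz_nat.
by rewrite -[(`|_|).+1]addn1 PoszD [`|_|%N%:Z]cycle_posE modzDml.
Qed.

(** Each summand of [cycleA] gives one factor; for n = 1 the two factors coincide, in accordance
    with the double edge. *)
Lemma prod_cycleA (f : 'I_(2 * n) -> F) z :
  \prod_p f p ^+ cycleA p (cycle_pos z) = f (cycle_pos (z - 1)) * f (cycle_pos (z + 1)).
Proof.
rewrite -(prod_pred1_exp f (cycle_pos (z - 1))) -(prod_pred1_exp f (cycle_pos (z + 1))).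
rewrite -big_split /=; apply: eq_bigr => p _; rewrite -exprD; congr (_ ^+ (_ + _)).
  by rewrite -[z in LHS](subrK 1) cycle_posS -[p == _](inj_eq (@ordS_inj _)) eq_sym.
by rewrite cycle_posS.
Qed.
End PathCycle.

Lemma pathA_sym m (i i' : 'I_m) : pathA i i' = pathA i' i.
Proof. by rewrite /pathA addnC. Qed.

Lemma cycleA_sym n (i i' : 'I_(2 * n)) : cycleA i i' = cycleA i' i.
Proof. by rewrite /cycleA addnC. Qed.

Section Bipartitions.
Variables (m n : nat) (n_gt0 : (0 < n)%N) (c : 'I_m -> bool) (c' : 'I_(2 * n) -> bool).
Hypotheses (hc : is_bipartition (@pathA m) c) (hc' : is_bipartition (@cycleA n) c').

Lemma path_colour (q0 q : 'I_m) : q0 = 0%N :> nat -> c q = c q0 (+) odd q.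
Proof.
move=> q00; case: q => q lt_qm; elim: q lt_qm => [|q IHq] lt_qm.
  by rewrite addbF; congr c; apply: val_inj.
have := hc (i := Ordinal (ltnW lt_qm)) (i' := Ordinal lt_qm).
rewrite /pathA /= eqxx (IHq (ltnW lt_qm)) /= => /(_ isT).
by case: (c q0); case: (odd q); case: (c _).
Qed.

Lemma cycle_colourS z : c' (cycle_pos n_gt0 (z + 1)) = ~~ c' (cycle_pos n_gt0 z).
Proof.
rewrite cycle_posS; set p := cycle_pos n_gt0 z.
have := hc' (i := p) (i' := ordS p); rewrite /cycleA /= eqxx => /(_ isT).
by case: (c' _); case: (c' _).
Qed.

Lemma cycle_colour z : c' (cycle_pos n_gt0 z) = c' (cycle_pos n_gt0 0) (+) ~~ (2 %| z)%Z.
Proof.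
have evenS y : ~~ (2 %| y + 1)%Z = ~~ ~~ (2 %| y)%Z by lia.
elim/int_rec: z => [|k IHk|k IHk].
- by rewrite addbF.
- by rewrite -addn1 PoszD cycle_colourS IHk evenS !addbN.
apply: negb_inj; rewrite -addbN -evenS -cycle_colourS.
by rewrite -addn1 PoszD opprD subrK.
Qed.

End Bipartitions.

(** * From exchange relations to linearizability *)

Section TSystem.
Variables (C : fieldType) (m n : nat) (m_gt0 : (0 < m)%N) (n_gt0 : (0 < n)%N).
Variables (c : 'I_m -> bool) (c' : 'I_(2 * n) -> bool).
Hypotheses (hc : is_bipartition (@pathA m) c) (hc' : is_bipartition (@cycleA n) c').
Local Notation V := ('I_m * 'I_(2 * n))%type.
Local Notation F := (ratfun C V).
Variable mu : field_aut F.
Hypothesis mu_bip : is_bipartite_map (@pathA m) (@cycleA n) c c' mu.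

Let q0 : 'I_m := Ordinal m_gt0.
Let pos := cycle_pos n_gt0.

(* Chosen so that the vertex of level i at position x - y + shift is black
   exactly when x + y + i is even. *)
Let shift : int := if c q0 == c' (pos 0) then 1 else 0.

Let a (k : int) (v : V) : F := aut_pow mu k (ratX C v).

(* T_i at position x - y and time x + y + i - 1, the value of the T-system
   corresponding to the solid i x i minor with upper left corner (x, y). *)
Let t (i : nat) (x y : int) : F :=
  level (fun q => a ((x + y + i%:Z) %/ 2)%Z (q, pos (x - y + shift))) i.

Let black_parity (q : 'I_m) (x y : int) :
  (c q == c' (pos (x - y + shift))) = (2 %| x + y + q.+1%:Z)%Z.
Proof.
rewrite (path_colour hc (q0 := q0)) // (cycle_colour n_gt0 hc') /shift -/pos.
have odd_int (k : nat) : odd k = ~~ (2 %| k%:Z)%Z by lia.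
rewrite odd_int; case: (c q0) (c' (pos 0)) => [] [] /=; lia.
Qed.

Let t_octahedron i x y : (0 < i < m.+1)%N ->
  t i x y * t i (x + 1) (y + 1) =
  t i.-1 (x + 1) (y + 1) * t i.+1 x y + t i (x + 1) y * t i x (y + 1).
Proof.
case: i => // i lt_im; rewrite succnK; pose q : 'I_m := Ordinal (lt_im : (i < m)%N).
pose k := ((x + y + i.+1%:Z) %/ 2)%Z.
pose z := x - y + shift.
(* The time of all neighbours: [k] if x + y + i + 1 is even, which is the black case, and k + 1
   otherwise. *)
pose k' := ((x + y + i.+1%:Z + 1) %/ 2)%Z.
have -> : t i.+1 x y = a k (q, pos z) by rewrite /t (levelS _ q).
have -> : t i.+1 (x + 1) (y + 1) = a (k + 1) (q, pos z).
  rewrite /t (levelS _ q) /k /z; congr (a _ (_, pos _)); [lia | ring].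
have -> : t i.+1 (x + 1) y = a k' (q, pos (z + 1)).
  rewrite /t (levelS _ q) /k' /z; congr (a (_ %/ _)%Z (_, pos _)); ring.
have -> : t i.+1 x (y + 1) = a k' (q, pos (z - 1)).
  rewrite /t (levelS _ q) /k' /z; congr (a (_ %/ _)%Z (_, pos _)); ring.
have -> : t i (x + 1) (y + 1) = level (fun q => a k' (q, pos z)) i.
  have -> : z = x + 1 - (y + 1) + shift by rewrite /z; ring.
  have eq_time : x + 1 + (y + 1) + i%:Z = x + y + i.+1%:Z + 1.
    by rewrite -[i.+1]addn1 PoszD; ring.
  by rewrite /t eq_time.
have -> : t i.+2 x y = level (fun q => a k' (q, pos z)) i.+2.
  by rewrite /t /k' -[i.+2]addn1 PoszD addrA.
have /= := aut_pow_exchange (@pathA_sym m) (@cycleA_sym n) hc hc' mu_bip k (q, pos z).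
rewrite /z black_parity -/z -/(a (k + 1) (q, pos z)) -/(a k (q, pos z)) mulrC => ->.
have -> : (if (2 %| x + y + q.+1%:Z)%Z then k else k + 1) = k'.
  by rewrite /k /k' /=; case: ifP; lia.
by rewrite /box_exchange /= prod_pathA prod_cycleA; congr (_ + _); rewrite mulrC.
Qed.

Theorem T_system_linearizable (q : 'I_m) (q' : 'I_(2 * n)) :
  linearizable (fun k => aut_pow mu k (ratX C (q, q'))) (n * 'C(m.+1, q.+1)).
Proof.
have t0 x y : t 0 x y = 1 by [].
have t_top x y : t m.+1 x y = 1 by apply: level_top.
have t_neq0 i x y : (i <= m.+1)%N -> t i x y != 0.
  case: i => [|i]; first by rewrite oner_eq0.
  rewrite ltnS leq_eqVlt => /predU1P[->|lt_im]; first by rewrite t_top oner_eq0.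
  by rewrite /t (levelS _ (Ordinal lt_im)) (aut_pow_neq0).
have t_period x y : t 1 (x + n%:Z) y = t 1 x (y + n%:Z).
  (* Both sides have the same time, and their positions differ by 2n. *)
  rewrite /t !(levelS _ q0) -[in RHS](cycle_pos_period n_gt0 : forall z, pos _ = pos z).
  congr (a (_ %/ _)%Z (_, pos _)); rewrite ?mul2n -?addnn ?PoszD; ring.
have [p p1 rec_p] := octahedron_recurrence (ltn0Sn m) t0 t_top t_neq0 t_octahedron
  t_period (leqW (ltn_ord q)).
apply: (linearizable_of_recurrence (q := fun s => p`_s)) => // k.
(* [x] and [y] solve x - y + shift = q' and floor((x + y + q + 1)/2) = k; adding ns to both raises
   the time by ns and keeps the position. *)
pose p0 := q'%:Z - shift.
pose y := - ((p0 + q.+1%:Z) %/ 2)%Z + k; pose x := y + p0.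
rewrite -[RHS](rec_p x y); apply: eq_bigr => s _; congr (_ * _).
rewrite /t levelS; congr (a _ (_, _)); first by rewrite /x /y; lia.
by rewrite -[LHS](cycle_pos_ord n_gt0); congr pos; rewrite /x /p0; ring.
Qed.
End TSystem.

Theorem mainTheorem2 (R : realType) (m n : nat) (hm : (1 <= m)%N)
    (hn : (1 <= n)%N) (c : 'I_m -> bool) (c' : 'I_(2 * n) -> bool)
    (hc : is_bipartition (@pathA m) c) (hc' : is_bipartition (@cycleA n) c') :
  (exists mu : field_aut (ratfun R[i] ('I_m * 'I_(2 * n))%type),
     is_bipartite_map (@pathA m) (@cycleA n) c c' mu) /\
  (forall mu : field_aut (ratfun R[i] ('I_m * 'I_(2 * n))%type),
     is_bipartite_map (@pathA m) (@cycleA n) c c' mu ->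
     forall (j : nat) (q : 'I_m) (q' : 'I_(2 * n)),
       (j = q.+1 \/ j = m - q)%N ->
       linearizable (fun k : int => aut_pow mu k (ratX R[i] (q, q')))
                    (n * 'C(m.+1, j))).
Proof.
split=> [|mu mu_bip j q q' j_q].
  apply: bipartite_map_exists => //; [exact: pathA_sym | exact: cycleA_sym |].
  by rewrite Num.Theory.pnatr_eq0.
(* Counting from the other end replaces q + 1 by m - q, its complement in m + 1. *)
have -> : 'C(m.+1, j) = 'C(m.+1, q.+1).
  case: j_q => -> //; rewrite -bin_sub; last by rewrite leqW // leq_subr.
  by congr 'C(_, _); rewrite subSn ?leq_subr // subKn // ltnW.
exact: (T_system_linearizable hm hn hc hc' mu_bip).
Qed.
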